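(* The online non-clairvoyant rate-assignment (water-filling) algorithm described in the context, run on the given machines (i.e. with $\gamma=1$), has competitive ratio $O(\min\{K^3\log^2 K,\ K+\log n\})$ for bag-of-tasks scheduling on related machines, where $K$ is the number of distinct machine speeds and $n$ the number of tasks.
   Context: Bag-of-tasks scheduling on related machines: there are $m$ machines with speeds $s_1\ge s_2\ge\dots\ge s_m>0$; $K$ is the number of distinct speeds, and $S_k:=s_1+\dots+s_k$ (with $S_k:=S_m$ for $k>m$). Each job $j$ has a weight $w_j\ge0$ and a finite set $T(j)$ of tasks; task $v$ has processing requirement $p_v\ge 0$; all jobs are released at time $0$. Tasks may be preempted and migrated; a task runs on at most one machine at any time, but different tasks may run concurrently on different machines; a machine of speed $s$ running a task for $\varepsilon$ time does $s\varepsilon$ units of processing on it. A job completes at time $C_j$ when all its tasks have received their full processing requirement; the objective is $\sum_j w_jC_j$. Non-clairvoyance: the algorithm learns $p_v$ only when $v$ finishes. Competitive ratio: supremum over instances of (algorithm's objective)/(optimal offline objective on the same machines). The algorithm (with parameter $\gamma\ge1$): at each time $t$, let $T^t(j)$ be the set of unfinished tasks of job $j$. Raise a parameter $\tau$ continuously from $0$. Each not-yet-frozen task $v\in T^t(j)$ has tentative rate $L^t_v=\frac{w_j}{|T^t(j)|}\tau$. Whenever some subset $V$ of alive tasks satisfies $\sum_{v\in V}L^t_v=\gamma S_{|V|}$, a maximal such set is chosen and its tasks are frozen, fixing their rates at their current values; this continues until all alive tasks are frozen. The resulting rates satisfy $\sum_{v\in V}L^t_v\le\gamma S_{|V|}$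 for every set $V$ of alive tasks, and each alive task $v$ is processed at rate $L^t_v$ at time $t$ (such rates can be realized by a preemptive schedule on machines of speeds $\gamma s_1,\dots,\gamma s_m$). *)

(* Defs.v *)
From HB Require Import structures.
From mathcomp Require Import all_boot all_order all_algebra.
From mathcomp Require Import all_classical all_reals all_analysis.
From mathcomp Require Import measurable_realfun lra.
Set Implicit Arguments.
Unset Strict Implicit.
Unset Printing Implicit Defensive.
Import Order.TTheory GRing.Theory Num.Theory.
Import numFieldNormedType.Exports.
Local Open Scope classical_set_scope.
Local Open Scope ring_scope.

Record instance (R : realType) := Instance {
  machines : nat;
  speed : 'I_machines -> R;
  job : finType;
  weight : job -> R;
  task : finType;
  job_of : task -> job;  (* T(j) is the fibre of job_of over j *)
  requirement : task -> R;
  machines_gt0 : (0 < machines)%N;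
  speed_gt0 : forall i, 0 < speed i;
  speed_nonincreasing : forall i k : 'I_machines, (i <= k)%N -> speed k <= speed i;
  weight_ge0 : forall j, 0 <= weight j;
  requirement_ge0 : forall v, 0 <= requirement v }.

Section BagOfTasks.
Variables (R : realType) (I : instance R).
Implicit Types (A V : {set task I}) (v : task I) (j : job I) (t tau gamma : R).

Definition num_speeds : nat := size (undup (codom (@speed R I))).

Definition num_tasks : nat := #|task I|.

(* The sum of the k largest speeds; the whole sum when k exceeds machines I. *)
Definition total_speed (k : nat) : R :=
  \sum_(i < machines I | (i < k)%N) speed i.

(* In the next two definitions y v t is the amount of processing that task v
   has received during [0, t].  A job without tasks completes at time 0, and a
   job that never completes has completion time +oo, which contributes 0 to the
   objective when its weight is 0. *)
Definition completion_time (y : task I -> R -> R) j : \bar R :=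
  ereal_inf [set t%:E | t in
    [set t | 0 <= t /\ forall v, job_of v = j -> requirement v <= y v t]].

Definition objective (y : task I -> R -> R) : \bar R :=
  (\sum_j (weight j)%:E * completion_time y j)%E.

(* sigma i t is the task that machine i runs at time t, if any. *)
Definition is_schedule (sigma : 'I_(machines I) -> R -> option (task I)) : Prop :=
  (forall i v, measurable [set t | sigma i t = Some v]) /\
  (forall t i k v, sigma i t = Some v -> sigma k t = Some v -> i = k).

Definition schedule_processing
    (sigma : 'I_(machines I) -> R -> option (task I)) v t : R :=
  \sum_i speed i *
    fine (lebesgue_measure ([set u | sigma i u = Some v] `&` `[0, t])).

Definition optimum : \bar R :=
  ereal_inf [set objective (schedule_processing sigma) | sigma in is_schedule].

Definition share A v : R :=
  weight (job_of v) / #|[set u in A | job_of u == job_of v]%SET|%:R.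

(* frozen_rate is meaningful on the frozen set only. *)
Record filling := Filling {
  level : R;
  frozen : {set task I};
  frozen_rate : task I -> R }.

Definition tentative_rate A (st : filling) tau v : R :=
  if v \in frozen st then frozen_rate st v else share A v * tau.

(* Tight sets that are already frozen (such as the empty set) trigger nothing. *)
Definition tight gamma A (st : filling) tau V : bool :=
  [&& V \subset A, ~~ (V \subset frozen st) &
      \sum_(v in V) tentative_rate A st tau v == gamma * total_speed #|V|].

Definition next_level gamma A (st : filling) : R :=
  inf [set tau | level st <= tau /\ exists V, tight gamma A st tau V].

Definition freeze gamma A (st : filling) : filling :=
  let tau := next_level gamma A st in
  if [pick V | maxset (tight gamma A st tau) V] is Some V
  then Filling tau (frozen st :|: V) (tentative_rate A st tau)
  else st.

(* Every effective freeze adds a task, so #|A| of them suffice.  An alive task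
   can remain unfrozen for all tau only if its job has weight 0, and then its
   tentative rate is constantly 0. *)
Definition rate gamma A v : R :=
  let st := iter #|A| (freeze gamma A) (Filling 0 finset.set0 (fun=> 0)) in
  if v \in frozen st then frozen_rate st v else 0.

Definition alive (y : task I -> R -> R) t : {set task I} :=
  [set v | y v t < requirement v]%SET.

Definition is_run gamma (y : task I -> R -> R) : Prop :=
  forall v t, 0 <= t ->
    (y v t)%:E =
      (\int[lebesgue_measure]_(u in `[0%R, t]) (rate gamma (alive y u) v)%:E)%E.

End BagOfTasks.

(* The logarithm of K is offset by 1 so that the bound does not vanish at K = 1. *)
Definition ratio_bound (R : realType) (K n : nat) : R :=
  Num.min (K%:R ^+ 3 * (1 + ln K%:R) ^+ 2) (K%:R + ln n%:R).

(* The trajectory specified by is_run always exists. *)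
Section RunExists.
Variables (R : realType) (I : instance R).
Implicit Types (A V : {set task I}) (v : task I).

Lemma rate_ge0 gamma A v : 0 <= rate gamma A v.
Proof.
pose inv (st : filling I) :=
  0 <= level st /\ forall v, v \in frozen st -> 0 <= frozen_rate st v.
suff H n : inv (iter n (freeze gamma A) (Filling 0 finset.set0 (fun=> 0))).
  rewrite /rate; case: ifP => // /((H _).2 v) //.
elim: n => [|n]; first by split => // w; rewrite inE.
rewrite iterS; move: (iter n _ _) => st [l0 f0].
rewrite /freeze; case: pickP => // V _.
have nl0 : 0 <= next_level gamma A st.
  rewrite /next_level; set B := [set _ | _].
  have [->|/set0P B0] := eqVneq B set0; first by rewrite inf0.
  by apply: lb_le_inf => // x [/(le_trans l0)].
split => //= w _; rewrite /tentative_rate; case: ifP => [/f0 //|_].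
by rewrite mulr_ge0 // /share divr_ge0 ?weight_ge0.
Qed.

Lemma fluid_run_const (L : {set task I} -> task I -> R) (L0 : forall A v, 0 <= L A v) (a : R) (q : task I -> R) :
  let A := [set v | (q v < requirement v)%R]%SET in
  (forall v, ~~ ((v \in A) && (0 < L A v))) ->
  exists y : task I -> R -> R,
   (forall v, measurable_fun `[a, +oo[ (fun u : R => L (alive y u) v : R)) /\
   (forall v t, a <= t -> (y v t)%:E =
     ((q v)%:E + \int[lebesgue_measure]_(u in `[a, t]) (L (alive y u) v)%:E)%E).
Proof.
move=> A N; pose y v t := q v + (t - a) * L A v.
have al u : a <= u -> alive y u = A.
  move=> au; apply/setP => v; have := N v; rewrite !inE /y.
  have := L0 A v; case: (ltP (q v) (requirement v)) => [qv Lv /=|qv Lv _].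
    by rewrite -leNgt => Lv'; have -> : L A v = 0 by [lra]; rewrite mulr0 addr0.
  by apply/negbTE; rewrite -leNgt (le_trans qv)// lerDl mulr_ge0// subr_ge0.
exists y; split=> [v|v t at_].
  apply: (eq_measurable_fun (cst (L A v))) => // u.
  by rewrite inE /= in_itv /= andbT => au; rewrite al.
rewrite (eq_integral (cst (L A v)%:E)) => [|u]; last first.
  by rewrite inE /= in_itv /= => /andP[au _]; rewrite al.
rewrite integral_cst//= lebesgue_measure_itv/= lte_fin; case: ltP => h.
  by rewrite -EFinB -EFinM -EFinD mulrC.
by have -> : t = a by [lra]; rewrite mule0 adde0 /y subrr mul0r addr0.
Qed.

Lemma fluid_run_exists (L : {set task I} -> task I -> R) (L0 : forall A v, 0 <= L A v) k :
  forall (a : R) (q : task I -> R), (#|[set v | (q v < requirement v)%R]%SET| <= k)%N ->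
  exists y : task I -> R -> R,
   (forall v, measurable_fun `[a, +oo[ (fun u : R => L (alive y u) v : R)) /\
   (forall v t, a <= t -> (y v t)%:E =
     ((q v)%:E + \int[lebesgue_measure]_(u in `[a, t]) (L (alive y u) v)%:E)%E).
Proof.
elim: k => [|k IH] a q; set A := [set v | _]%SET => Ak.
all: have [/existsP[v0 /andP[v0A Lv0]]|/existsPn N] :=
   boolP [exists v, (v \in A) && (0 < L A v)].
1: by move: Ak; rewrite leqn0 => /eqP/cards0_eq A0; rewrite A0 inE in v0A.
1,3: exact: fluid_run_const.
pose P v := (v \in A) && (0 < L A v).
pose f v := (requirement v - q v) / L A v.
have Pv0 : P v0 by rewrite /P v0A.
case: (@Order.TotalTheory.arg_minP _ _ _ v0 P f Pv0) => w /andP[wA Lw] wmin.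
have f0 : 0 < f w by rewrite divr_gt0// subr_gt0; move: wA; rewrite inE.
have [] := IH (a + f w) (fun v => q v + f w * L A v).
  rewrite -ltnS (leq_trans _ Ak)//; apply: proper_card; apply/properP; split.
    apply/fintype.subsetP => v; rewrite !inE; apply: le_lt_trans.
    by rewrite lerDl mulr_ge0// ltW.
  exists w => //; rewrite inE -leNgt /f -mulrA mulVf ?gt_eqF//; lra.
move=> y' [my' iy'].
pose y v t := if t < a + f w then q v + (t - a) * L A v else y' v t.
have al u : a <= u -> u < a + f w -> alive y u = A.
  move=> au ub; apply/setP => v; rewrite !inE /y ub.
  case: (ltP (q v) (requirement v)) => qv; last first.
    by apply/negbTE; rewrite -leNgt (le_trans qv)// lerDl mulr_ge0// subr_ge0.
  have := L0 A v; rewrite le_eqVlt => /orP[/eqP<-|Lv]; first lra.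
  have Pv : P v by rewrite /P inE qv.
  have : u - a < f v by apply: lt_le_trans (wmin _ Pv); lra.
  by rewrite /f ltr_pdivlMr//; lra.
have al' u : a + f w <= u -> alive y u = alive y' u.
  by move=> bu; apply/setP => v; rewrite !inE /y [u < _]ltNge bu.
have m1 v : measurable_fun `[a, (a + f w)[ (fun u : R => L (alive y u) v : R).
  apply: (eq_measurable_fun (cst (L A v))) => // u.
  by rewrite inE/= in_itv/= => /andP[au ub]; rewrite al.
have m2 v : measurable_fun `[a + f w, +oo[ (fun u : R => L (alive y u) v : R).
  apply: eq_measurable_fun (my' v) => u.
  by rewrite inE/= in_itv/= andbT => bu; rewrite al'.
have U (c : itv_bound R) : (BLeft (a + f w) <= c)%O ->
   [set` Interval (BLeft a) c] = `[a, (a + f w)[ `|` [set` Interval (BLeft (a + f w)) c].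
  move=> bc; rewrite -itv_bndbnd_setU// bnd_simp; lra.
have fa v t : a <= t -> t <= a + f w -> (\int[lebesgue_measure]_(u in `[a, t[) (L (alive y u) v)%:E = ((t - a) * L A v)%:E)%E.
  move=> at_ tb.
  rewrite (eq_integral (cst (L A v)%:E)) => [|u]; last first.
    by rewrite inE/= in_itv/= => /andP[au ut]; rewrite al// (lt_le_trans ut).
  rewrite integral_cst//= lebesgue_measure_itv/= lte_fin; case: ltP => h.
    by rewrite -EFinB -EFinM mulrC.
  have -> : t = a by lra.
  by rewrite mule0 subrr mul0r.
have m3 v : measurable_fun `[a, +oo[ (fun u : R => L (alive y u) v : R).
  by rewrite U//; apply/measurable_funU.
exists y; split => // v t at_.
have [tb|bt] := ltP t (a + f w).
  rewrite (_ : y v t = q v + (t - a) * L A v); last by rewrite /y tb.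
  rewrite -integral_itv_bndo_bndc; last first.
    apply/measurable_EFinP; apply: measurable_funS (m3 v) => //; by apply: subset_itvl; rewrite ?bnd_simp.
  by rewrite (fa v t at_ (ltW tb)) EFinD.
rewrite (_ : y v t = y' v t); last by rewrite /y ltNge bt.
rewrite iy'// EFinD -addeA; congr (_ + _)%E.
rewrite U ?bnd_simp// ge0_integral_setU//=; last 3 first.
- apply/measurable_EFinP; apply/measurable_funU => //; split; first exact: m1.
  by apply: measurable_funS (m2 v) => //; apply: subset_itvl; rewrite ?bnd_simp.
- by move=> u ?; rewrite lee_fin.
- apply/disj_setPLR => u /=; rewrite !in_itv/= => /andP[_ ub]; apply/negP; rewrite negb_and -ltNge ub//.
rewrite fa//; last by rewrite lerDl ltW.
congr (_ + _)%E; first by rewrite addrAC subrr add0r.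
by apply: eq_integral => u; rewrite inE/= in_itv/= => /andP[bu _]; rewrite al'.
Qed.

Lemma run_exists gamma : exists y : task I -> R -> R, is_run gamma y.
Proof.
have [y [_ Hy]] := fluid_run_exists (rate_ge0 gamma) 0 (leqnn #|[set v : task I | (0 < requirement v)%R]%SET|).
by exists y => v t t0; rewrite Hy// add0e.
Qed.
End RunExists.

(* Main.v *)
(** Only the number K of speed classes enters the bound: the algorithm is in
    fact 48K-competitive.

    Let W be the total weight of the jobs alive in the algorithm, and let a
    task v have the share delta_v = w_j / |T(j)|.  If m(i) machines are as fast
    as machine i, water-filling gives every alive task the rate
      L_v >= s_i * min(1, delta_v * m(i) / W):
    when L_v < s_i, the tight set that froze v is larger than the number of
    machines of speed at least s_i, so it absorbs the capacity m(i) * s_i.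

    The rest is dual fitting against an adversary slowed down by a factor gam.
    The weight of an unfinished job is charged to its alive tasks according to
    their shares.  Machine i pays W / m(i) per unit of time, which is K * W in
    total and covers the charges made while delta_v * m(i) < W.  Machines with
    delta_v * m(i) >= W are slow for v, and are covered by a price eta_v paid by
    the task.  Keeping the prices eta_v of a job small despite the growth of the
    shares is the crux: classify the times at which the job is alive by the
    largest such speed r, and weight the charge at a time of class r by the
    fraction of the class that has already elapsed.  This loses only a factor 2
    in the total charge (by symmetrisation), and since a task alive at that time
    has already received r times the elapsed length, each class contributes at
    most w_j to the sum of the eta_v, hence (K + 1) * w_j altogether. *)

Require Import Defs.
From HB Require Import structures.
From mathcomp Require Import all_boot all_order all_algebra.
From mathcomp Require Import all_classical all_reals all_analysis.
From mathcomp Require Import measurable_realfun lra ring.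
Set Implicit Arguments.
Unset Strict Implicit.
Unset Printing Implicit Defensive.
Import Order.TTheory GRing.Theory Num.Theory.
Import numFieldNormedType.Exports.
Local Open Scope classical_set_scope.
Local Open Scope ring_scope.

(** * Sums over classes *)

(** The quotients of one class share their denominator, so they sum to 1, or to 0 when the class
    total vanishes. *)
Lemma sum_div_class_le (R : realFieldType) (T : finType) (E : eqType)
    (f : T -> E) (d : T -> R) :
  \sum_t d t / \sum_(u | f u == f t) d u <= (size (undup (codom f)))%:R.
Proof.
set s := undup _.
rewrite (eq_bigr (fun t => \sum_(c <- s | f t == c) d t / \sum_(u | f u == c) d u)); last first.
  move=> t _; rewrite -[RHS]big_filter (_ : [seq c <- s | f t == c] = [:: f t]) ?big_seq1//.
  rewrite (eq_filter (a2 := pred1 (f t))) => [|c /=]; last by rewrite eq_sym.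
  by rewrite filter_pred1_uniq ?undup_uniq// mem_undup codom_f.
rewrite (exchange_big_dep xpredT)//= -sum1_size natr_sum; apply: ler_sum => c _.
rewrite -mulr_suml; set D := \sum_(_ | _) _.
by have [->|D0] := eqVneq D 0; rewrite ?mul0r// divff.
Qed.

(** Symmetrisation: [d l] is a row sum of the symmetric kernel [G], and the prefixes select the
    pairs with [k <= l]. Transposing yields the pairs with [l <= k], so twice the prefix sum covers
    every pair. *)
Lemma sum_le_twice_prefix (R : realFieldType) (N : nat) (E : eqType)
    (f : 'I_N -> E) (d : 'I_N -> R) : (forall l, 0 <= d l) ->
  \sum_l d l <= 2 * \sum_l d l * ((\sum_(k | (f k == f l) && (k <= l)%N) d k) /
                                  \sum_(k | f k == f l) d k).
Proof.
move=> d0; pose D l := \sum_(k | f k == f l) d k.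
pose G (l k : 'I_N) := if f k == f l then d l * d k / D l else 0.
have GC l k : G l k = G k l.
  rewrite /G eq_sym; case: eqP => // e; rewrite (mulrC (d l)); congr (_ / _).
  by rewrite /D e.
have G0 l k : 0 <= G l k.
  by rewrite /G; case: ifP => // _; rewrite divr_ge0 ?mulr_ge0 ?sumr_ge0.
have eG l : d l = \sum_k G l k.
  rewrite -big_mkcond /= -mulr_suml -mulr_sumr -/(D l).
  have [D0|D0] := eqVneq (D l) 0; last by rewrite mulfK.
  rewrite D0 mulr0 mul0r; apply/le_anti; rewrite d0 andbT -D0.
  by rewrite /D (bigD1 l)//= lerDl sumr_ge0.
have eH l : d l * ((\sum_(k | (f k == f l) && (k <= l)%N) d k) / D l) =
   \sum_(k : 'I_N | (k <= l)%N) G l k.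
  rewrite big_mkcondr /= mulrA mulr_sumr mulr_suml [RHS]big_mkcond /= big_mkcond /=.
  apply: eq_bigr => k _; rewrite /G; case: ifP => _; case: ifP => //.
  by rewrite mulr0 mul0r.
rewrite (eq_bigr _ (fun l _ => eG l)) (eq_bigr _ (fun l _ => eH l)).
have eS : \sum_(l < N) \sum_(k : 'I_N | (k <= l)%N) G l k =
    \sum_(l < N) \sum_(k : 'I_N | (l <= k)%N) G l k.
  rewrite (exchange_big_dep xpredT)//=; apply: eq_bigr => l _.
  by apply: eq_bigr => k _; exact: GC.
rewrite mulr2n mulrDl mul1r {2}eS -big_split/=.
apply: ler_sum => l _; rewrite [leLHS](bigID (fun k : 'I_N => (k <= l)%N)) /=.
rewrite lerD2l big_mkcond [leRHS]big_mkcond/=; apply: ler_sum => k _.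
by rewrite -ltnNge; case: ifP => [/ltnW -> // |_]; case: ifP.
Qed.

(** * Rates produced by water-filling *)

Section WaterFilling.
Variables (R : realType) (I : instance R) (gamma : R) (A : {set task I}).
Hypothesis gamma_ge0 : 0 <= gamma.
Implicit Types (V : {set task I}) (v : task I) (i : 'I_(machines I)) (st : filling I).

Definition filled st V tau : R := \sum_(v in V) tentative_rate A st tau v.

(** The last clause stores a certificate for each frozen task: the tight set that froze it and the
    level of that moment. Other members may have frozen earlier, at lower levels, whence the
    inequality. Frozen rates never change, so certificates persist. *)
Definition filling_invariant st : Prop :=
  [/\ 0 <= level st,
      forall V, V \subset A -> filled st V (level st) <= gamma * total_speed I #|V|
    & forall v, v \in frozen st -> exists V tau,
       [/\ (v \in V) && (V \subset frozen st :&: A), tau <= level st,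
           frozen_rate st v = share A v * tau,
           forall u, u \in V -> frozen_rate st u <= share A u * tau
         & \sum_(u in V) frozen_rate st u = gamma * total_speed I #|V|]].

Lemma share_ge0 v : 0 <= share A v.
Proof. by rewrite divr_ge0 ?weight_ge0. Qed.

Lemma total_speed_ge0 k : 0 <= total_speed I k.
Proof. by rewrite sumr_ge0 // => i _; rewrite ltW ?speed_gt0. Qed.

(** The slope of [filled st V] as an affine function of the level. *)
Let unfrozen_share st V : R := \sum_(v in V | v \notin frozen st) share A v.

Let filled_frozen st V : V \subset frozen st ->
  forall tau tau', filled st V tau = filled st V tau'.
Proof.
move=> /fintype.subsetP VF tau tau'; apply: eq_bigr => v vV.
by rewrite /tentative_rate VF.
Qed.

Let filledE st V tau tau' :
  filled st V tau' = filled st V tau + unfrozen_share st V * (tau' - tau).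
Proof.
rewrite /filled /unfrozen_share mulr_suml big_mkcondr /= -big_split /=.
apply: eq_bigr => v _; rewrite /tentative_rate.
by case: ifP => _ /=; [rewrite addr0|ring].
Qed.

Let unfrozen_share_ge0 st V : 0 <= unfrozen_share st V.
Proof. by rewrite sumr_ge0// => v _; exact: share_ge0. Qed.

Let filled_mono st V tau tau' : tau <= tau' -> filled st V tau <= filled st V tau'.
Proof. by move=> h; rewrite (filledE st V tau tau') lerDl mulr_ge0 ?subr_ge0. Qed.

Let tightening st := [set tau | level st <= tau /\ exists V, tight gamma A st tau V].

(* Meaningful only if V becomes tight at some level >= level st. *)
Let tight_time st V : R := if unfrozen_share st V == 0 then level st
  else level st + (gamma * total_speed I #|V| - filled st V (level st)) / unfrozen_share st V.

Let tight_timeP st V tau : filling_invariant st -> level st <= tau ->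
  tight gamma A st tau V ->
  level st <= tight_time st V <= tau /\ tight gamma A st (tight_time st V) V.
Proof.
move=> [l0 inv2 _] lt /and3P[VA VF /eqP tV]; rewrite -/(filled st V tau) in tV.
have := inv2 V VA; have := tV; rewrite (filledE st V (level st) tau) /tight_time.
case: eqVneq => [b0|b0] e h.
  rewrite lexx lt; split=> //; apply/and3P; split => //; apply/eqP.
  by rewrite -/(filled _ _ _) -e b0 mul0r addr0.
have bp : 0 < unfrozen_share st V by rewrite lt0r b0 unfrozen_share_ge0.
set x := _ / _; have xe : level st + x = tau.
  by rewrite /x -e addrAC subrr add0r mulrAC divff// mul1r; lra.
by rewrite xe lt lexx; split => //; apply/and3P; split => //; apply/eqP.
Qed.

(** Each set that becomes tight has an earliest level, and there are finitely many sets, so the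
    infimum is attained. *)
Let next_level_min st : filling_invariant st -> tightening st !=set0 ->
  tightening st (next_level gamma A st) /\ lbound (tightening st) (next_level gamma A st).
Proof.
move=> inv [tau [lt [V tV]]].
pose P W := `[< exists2 tau, level st <= tau & tight gamma A st tau W >].
have PV : P V by apply/asboolP; exists tau.
case: (@arg_minP _ _ _ V P (tight_time st) PV) => W /asboolP[t1 lt1 tW] Wmin.
have [/andP[lW _] tW'] := tight_timeP inv lt1 tW.
have mem : tightening st (tight_time st W) by split => //; exists W.
have lb : lbound (tightening st) (tight_time st W).
  move=> t [lt' [V' tV']]; have [/andP[_ ]] := tight_timeP inv lt' tV'.
  by move=> + _; apply: le_trans; apply: Wmin; apply/asboolP; exists t.
suff -> : next_level gamma A st = tight_time st W by [].
apply/le_anti/andP; split.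
  by apply: ge_inf => //; exists (tight_time st W).
by apply: lb_le_inf => //; exists (tight_time st W).
Qed.

Let tightening_reached st V : filling_invariant st -> V \subset A ->
  forall tau, level st <= tau -> gamma * total_speed I #|V| <= filled st V tau ->
  ~~ (V \subset frozen st) ->
  exists2 tau', level st <= tau' <= tau & tight gamma A st tau' V.
Proof.
move=> [l0 inv2 _] VA tau lt ht VF; have h := inv2 V VA.
have [b0|b0] := eqVneq (unfrozen_share st V) 0.
  exists tau; first by rewrite lt lexx.
  apply/and3P; split => //; apply/eqP/le_anti; rewrite ht andbT.
  by rewrite -/(filled st V tau) (filledE st V (level st) tau) b0 mul0r addr0.
have bp : 0 < unfrozen_share st V by rewrite lt0r b0 unfrozen_share_ge0.
set x := (gamma * total_speed I #|V| - filled st V (level st)) / unfrozen_share st V.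
exists (level st + x).
  apply/andP; split; first by rewrite lerDl divr_ge0// ?subr_ge0.
  rewrite addrC -lerBrDr ler_pdivrMr//; move: ht; rewrite (filledE st V (level st) tau) mulrC; lra.
apply/and3P; split => //; rewrite -/(filled st V _) (filledE st V (level st)).
by rewrite addrAC subrr add0r mulrC divfK//; apply/eqP; ring.
Qed.

(** An unfrozen task of positive share would make its singleton tight at some level, so a freeze
    without progress leaves only zero shares. Capacities survive up to the new level: a set
    exceeding its capacity there would have become tight strictly before, against minimality. *)
Let freezeP st : filling_invariant st ->
  [/\ filling_invariant (freeze gamma A st),
      frozen st \subset frozen (freeze gamma A st)
    & (#|frozen st| < #|frozen (freeze gamma A st)|)%N \/
   forall v, v \in A -> v \notin frozen st -> share A v = 0].
Proof.
move=> inv; have [l0 inv2 inv3] := inv.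
rewrite /freeze; case: pickP => [V /maxsetP[tV _]|noV]; last first.
  split => //; right => v vA vF; apply/eqP; apply: contraT => sv.
  have sp : 0 < share A v by rewrite lt0r sv share_ge0.
  have b : unfrozen_share st [set v]%SET = share A v.
    rewrite /unfrozen_share (eq_bigl (fun u => u == v)) ?big_pred1_eq// => u.
    by rewrite inE; case: eqP => // ->; rewrite vF.
  have v1 : [set v]%SET \subset A by rewrite finset.sub1set.
  have [|||tau' /andP[lt' _] tV] := @tightening_reached st _ inv v1
     (level st + (gamma * total_speed I #|[set v]%SET| - filled st [set v]%SET (level st)) / share A v).
  - by rewrite lerDl divr_ge0 ?subr_ge0 ?inv2 ?share_ge0.
  - by rewrite (filledE st _ (level st)) b addrAC subrr add0r [share A v * _]mulrC divfK//; lra.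
  - by rewrite finset.sub1set.
  have [|[_ [W tW]] _] := next_level_min inv; first by exists tau'; split=> //; exists [set v]%SET.
  have [W' mW'] := ex_maxset (ex_intro _ W tW).
  by have := noV W'; rewrite mW'.
(* If nothing tightened, [next_level] would be the default value 0 of [inf]; but a set tight there
   is also tight at [level st], by monotonicity and the capacity bound. *)
have ne : tightening st !=set0.
  apply: contrapT => /set0P/negP/negPn/eqP e; move: tV.
  rewrite /next_level -/(tightening st) e inf0 => /and3P[VA VF /eqP tV].
  have : tightening st (level st).
    split => //; exists V; apply/and3P; split => //; apply/eqP/le_anti.
    by rewrite inv2//= -tV -/(filled st V 0); apply: filled_mono.
  by rewrite e.
have [[ltau _] lb] := next_level_min inv ne.
set tau := next_level _ _ _ in tV ltau lb *; have /and3P[VA VF /eqP eV] := tV.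
have tE u : tentative_rate A (Filling tau (frozen st :|: V) (tentative_rate A st tau)) tau u =
   tentative_rate A st tau u.
  by rewrite {1}/tentative_rate/= inE /tentative_rate; case: (u \in frozen st) => //=; case: ifP.
split; last first.
- left; apply: proper_card; rewrite properE finset.subsetUl /=.
  by apply: contra VF; apply: fintype.subset_trans; rewrite finset.subsetUr.
- exact: finset.subsetUl.
split => /=; first exact: le_trans ltau.
  move=> W WA; rewrite /filled (eq_bigr _ (fun u _ => tE u)) -/(filled st W tau).
  have [WF|WF] := boolP (W \subset frozen st).
    by rewrite (filled_frozen WF tau (level st)) inv2.
  rewrite leNgt; apply/negP => h.
  have [tau' /andP[lt' lt''] tW] := tightening_reached inv WA ltau (ltW h) WF.
  have e : tau' = tau.
    by apply/le_anti; rewrite lt'' lb//; split => //; exists W.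
  by move: tW h => /and3P[_ _ /eqP]; rewrite e -/(filled _ _ _) => ->; rewrite ltxx.
have frE u : u \in frozen st -> tentative_rate A st tau u = frozen_rate st u.
  by rewrite /tentative_rate => ->.
move=> v; rewrite inE; case: (boolP (v \in frozen st)) => /= [vF _|vF vV].
  have [W [t [/andP[vW /fintype.subsetP WF] tl fv fW eW]]] := inv3 v vF.
  have WF' u : u \in W -> u \in frozen st by move=> /WF; rewrite inE => /andP[].
  exists W, t; split => //.
  - by rewrite vW; apply/fintype.subsetP => u /WF; rewrite !inE => /andP[-> ->].
  - exact: le_trans tl ltau.
  - by rewrite frE.
  - by move=> u uW; rewrite frE ?WF'// fW.
  - by rewrite -eW; apply: eq_bigr => u uW; rewrite frE ?WF'.
(* A newly frozen task is certified by [V] and the new level. *)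
exists V, tau; split => //.
- by rewrite vV finset.subsetI finset.subsetUr.
- by rewrite /tentative_rate (negbTE vF).
- move=> u uV; rewrite /tentative_rate; case: ifP => // uF.
  have [W [t [_ tl -> _ _]]] := inv3 u uF.
  by rewrite ler_wpM2l ?share_ge0// (le_trans tl).
Qed.

(** Certificates keep frozen tasks inside [A], so [#|A|] strict enlargements exhaust [A] unless
    progress stops earlier, with only zero shares left. *)
Lemma final_filling : exists2 st, filling_invariant st &
  (forall v, v \in A -> v \notin frozen st -> share A v = 0) /\
  forall v, rate gamma A v = if v \in frozen st then frozen_rate st v else 0.
Proof.
pose F n := iter n (freeze gamma A) (Filling 0 finset.set0 (fun=> 0)).
have inv n : filling_invariant (F n).
  elim: n => [|n ih]; last by rewrite /F iterS; case: (freezeP ih).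
  split => //= [V VA|v]; last by rewrite inE.
  rewrite /filled big1 ?mulr_ge0 ?total_speed_ge0// => v vV.
  by rewrite /tentative_rate/= inE mulr0.
exists (F #|A|) => //; split => // v vA vF.
suff : (#|A| <= #|frozen (F #|A|)|)%N \/
    forall v, v \in A -> v \notin frozen (F #|A|) -> share A v = 0.
  case=> [AF|]; last exact.
  have FA : frozen (F #|A|) \subset A.
    apply/fintype.subsetP => u /(let: And3 _ _ i := inv #|A| in i u) [W [t [/andP[uW +] _ _ _ _]]].
    by move=> /fintype.subsetP/(_ u uW); rewrite inE => /andP[].
  have := vF; have /eqP -> : frozen (F #|A|) == A by rewrite eqEcard FA.
  by rewrite vA.
elim: #|A| => [|n [ih|ih]]; first by left.
  have [_ /fintype.subsetP s [h|h]] := freezeP (inv n); first by left; exact: leq_ltn_trans h.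
  by right => u uA uF; apply: h => //; apply: contra uF => /s.
have [_ /fintype.subsetP s _] := freezeP (inv n).
by right => u uA uF; apply: ih => //; apply: contra uF => /s.
Qed.

Definition multiplicity i : nat := #|[set k : 'I_(machines I) | speed k == speed i]%SET|.

(** Multiplied out by the total share to avoid dividing by 0. If [v] runs slower than
    [gamma * speed i], all machines of that speed have index below [#|V|] for the certificate [V].
    Their capacity is then at most the load of [V], hence at most the level times the total
    share. *)
Lemma rate_lower_bound i v : v \in A ->
  speed i * Num.min (gamma * (\sum_(u in A) share A u)) (gamma * (share A v * (multiplicity i)%:R))
    <= (\sum_(u in A) share A u) * rate gamma A v.
Proof.
move=> vA; set W := \sum_(u in A) _; have W0 : 0 <= W by rewrite sumr_ge0// => u _; exact: share_ge0.
have si := ltW (speed_gt0 i).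
have [st [l0 inv2 inv3] [unfr rE]] := final_filling.
have [s0|s0] := eqVneq (share A v) 0.
  rewrite s0 mul0r mulr0 (le_trans (y := 0))//; last by rewrite mulr_ge0 ?rate_ge0.
  by rewrite mulr_ge0_le0// ge_min lexx orbT.
have vF : v \in frozen st by apply: contraT => vF; rewrite (unfr v vA vF) eqxx in s0.
rewrite rE vF; have [V [t [/andP[vV /fintype.subsetP VF] tl fv' fV eV]]] := inv3 v vF.
have VF' u : u \in V -> u \in frozen st by move=> /VF; rewrite inE => /andP[].
have VA u : u \in V -> u \in A by move=> /VF; rewrite inE => /andP[].
have [Ls|Ls] := leP (gamma * speed i) (frozen_rate st v).
  apply: (@le_trans _ _ (speed i * (gamma * W))).
    by rewrite ler_wpM2l// ge_min lexx.
  by rewrite mulrCA mulrA mulrC ler_wpM2l// mulrC.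
have V0 : (0 < #|V|)%N by apply/card_gt0P; exists v.
(* The invariant gives no sign for certificate levels; it follows from the nonnegative load of
   [V]. *)
have t0 : 0 <= t.
  have sV : 0 < \sum_(u in V) share A u.
    rewrite (bigD1 v)//= ltr_pwDl ?sumr_ge0// => [|u _]; last exact: share_ge0.
    by rewrite lt0r s0 share_ge0.
  rewrite -(pmulr_lge0 _ sV) mulr_sumr; apply: (@le_trans _ _ (\sum_(u in V) frozen_rate st u)).
    by rewrite eV mulr_ge0 ?total_speed_ge0.
  by apply: ler_sum => u uV; rewrite mulrC fV.
have tW : gamma * total_speed I #|V| <= t * W.
  rewrite -eV mulrC mulr_suml [leRHS](bigID (mem V))/=.
  rewrite [X in _ <= X + _](eq_bigl (mem V)) => [|u]; last first.
    by rewrite /= andb_idl//; exact: VA.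
  apply: ler_wpDr; last by apply: ler_sum => u uV; exact: fV.
  by rewrite sumr_ge0// => u _; rewrite mulr_ge0 ?share_ge0.
have mS : speed i * (multiplicity i)%:R <= total_speed I #|V|.
  rewrite /multiplicity -sum1_card natr_sum mulr_sumr.
  rewrite (eq_bigr (fun k => speed k)) => [|k]; last by rewrite inE mulr1 => /eqP.
  rewrite /total_speed big_mkcond [leRHS]big_mkcond/=; apply: ler_sum => k _.
  rewrite inE; case: eqP => [ski|_]; last by case: ifP => // _; exact/ltW/speed_gt0.
  (* Without [v], the load of [V] fits into the first [#|V|.-1] machines, so [v] gets at least
     [gamma] times the speed of machine [#|V|.-1], which is no slower than any [k >= #|V|]. *)
  suff -> : (k < #|V|)%N by [].
  rewrite ltnNge; apply/negP => Vk; suff : gamma * speed i <= frozen_rate st v by lra.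
  have lastm : (#|V|.-1 < machines I)%N.
    by rewrite prednK// (leq_trans Vk)// ltnW.
  have := eV; rewrite (bigD1 v)//= => fvE.
  have : \sum_(u in V | u != v) frozen_rate st u <= gamma * total_speed I #|V|.-1.
    have sub : (V :\ v)%SET \subset A.
      by apply/fintype.subsetP => u; rewrite !inE => /andP[_ /VA].
    have := inv2 _ sub; have := cardsD1 v V; rewrite vV add1n => -> /=.
    apply: le_trans; rewrite /filled le_eqVlt; apply/orP; left; apply/eqP.
    rewrite (eq_bigl (fun u => u \in (V :\ v)%SET)) => [|u]; last by rewrite !inE andbC.
    apply: eq_bigr => u; rewrite !inE => /andP[_ uV].
    by rewrite /tentative_rate VF'.
  have eS : total_speed I #|V| = total_speed I #|V|.-1 + speed (Ordinal lastm).
    rewrite /total_speed (bigD1 (Ordinal lastm)) /=; last by rewrite prednK.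
    rewrite addrC; congr (_ + _); apply: eq_bigl => k'.
    by rewrite -(inj_eq val_inj)/= -{1}(prednK V0) ltnS andbC -ltn_neqAle.
  have : speed k <= speed (Ordinal lastm).
    by apply: speed_nonincreasing => /=; rewrite (leq_trans _ Vk)// leq_pred.
  rewrite ski => sk; move: fvE; have {sk} : gamma * speed i <= gamma * speed (Ordinal lastm).
    by rewrite ler_wpM2l.
  rewrite eS mulrDr; lra.
apply: (@le_trans _ _ (speed i * (gamma * (share A v * (multiplicity i)%:R)))).
  by rewrite ler_wpM2l// ge_min lexx orbT.
rewrite fv' [leLHS](_ : _ = share A v * (gamma * (speed i * (multiplicity i)%:R))); last by ring.
rewrite [leRHS](_ : _ = share A v * (t * W)); last by rewrite mulrCA (mulrC W).
by rewrite ler_wpM2l ?share_ge0// (le_trans _ tW)// ler_wpM2l.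
Qed.
End WaterFilling.
(** * Dual fitting for piecewise constant alive sets *)

Section DualFitting.
Variables (R : realType) (I : instance R) (N : nat).
Variables (A : 'I_N -> {set task I}) (d : 'I_N -> R).
Hypothesis d_ge0 : forall l, 0 <= d l.
Hypothesis A_antitone : forall k l : 'I_N, (k <= l)%N -> A l \subset A k.
Hypothesis A_requirement : forall v l, v \in A l -> 0 < requirement v.
Hypothesis processed_le : forall v,
  \sum_(l | v \in A l) rate 1 (A l) v * d l <= requirement v.
Implicit Types (v : task I) (j : job I) (i : 'I_(machines I)) (k l : 'I_N).

Local Notation K := (num_speeds I)%:R.

Definition alive_weight l : R := \sum_(v in A l) share (A l) v.
Local Notation W := alive_weight.

Let job_share j l : R := weight j / #|[set u in A l | job_of u == j]%SET|%:R.

Let active j l := [exists v in A l, job_of v == j].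

Definition active_length j l : R := if active j l then d l else 0.
Local Notation dj := active_length.

(* By rate_lower_bound, the alive tasks of j run at least at this speed on piece l. *)
Let class j l : R :=
  \big[Num.max/0]_(i : 'I_(machines I) | W l <= job_share j l * (multiplicity i)%:R) speed i.

Let class_length j l : R := \sum_(k | class j k == class j l) dj j k.

Let elapsed j l : R := \sum_(k | (class j k == class j l) && (k <= l)%N) dj j k.

Let charge v l : R := (if v \in A l then share (A l) v else 0) * d l *
  (elapsed (job_of v) l / class_length (job_of v) l).

(** Chosen so that [requirement v * eta v] pays for all charges of [v], each at the speed of its
    class. *)
Let eta v : R := (\sum_l class (job_of v) l * charge v l) / requirement v.

Let dj_ge0 j l : 0 <= dj j l.
Proof. by rewrite /dj; case: ifP. Qed.

Let class_ge0 j l : 0 <= class j l.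
Proof.
rewrite /class; elim/big_ind: _ => // [x y x0 y0|i _]; last exact/ltW/speed_gt0.
by rewrite le_max x0.
Qed.

Let elapsed_le j l : 0 <= elapsed j l <= class_length j l.
Proof.
rewrite sumr_ge0//= /elapsed big_mkcondr /=; apply: ler_sum => k _.
by case: ifP.
Qed.

Let fraction_itv j l : 0 <= elapsed j l / class_length j l <= 1.
Proof.
have /andP[e0 eD] := elapsed_le j l; have D0 := le_trans e0 eD.
rewrite divr_ge0//=; have [->|Dn0] := eqVneq (class_length j l) 0.
  by rewrite invr0 mulr0.
by rewrite ler_pdivrMr ?mul1r// lt0r Dn0.
Qed.

Let delta_ge0 v l : 0 <= (if v \in A l then share (A l) v else 0).
Proof. by case: ifP => // _; exact: share_ge0. Qed.

Let charge_ge0 v l : 0 <= charge v l.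
Proof.
apply: mulr_ge0; first by rewrite mulr_ge0.
by case/andP: (fraction_itv (job_of v) l).
Qed.

Let charge_le v l : charge v l <= (if v \in A l then share (A l) v else 0) * d l.
Proof. by rewrite /charge ler_piMr ?mulr_ge0//; case/andP: (fraction_itv (job_of v) l). Qed.

Let sum_share j l :
  \sum_(v | job_of v == j) (if v \in A l then share (A l) v else 0) =
    if active j l then weight j else 0.
Proof.
rewrite -big_mkcondr /=.
rewrite (eq_bigr (fun=> job_share j l)) => [|v /andP[/eqP <- _]//].
rewrite (eq_bigl (fun v => v \in [set u in A l | job_of u == j]%SET)) => [|v]; last first.
  by rewrite inE andbC.
rewrite sumr_const -mulr_natr /job_share; case: ifPn => [/exists_inP[v vA vj]|N0].
  by rewrite divfK// pnatr_eq0 -lt0n; apply/card_gt0P; exists v; rewrite inE vA.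
suff -> : #|[set u in A l | job_of u == j]%SET| = 0%N by rewrite mulr0.
apply/eqP; rewrite cards_eq0 -finset.subset0; apply/fintype.subsetP => v; rewrite !inE => /andP[vA vj].
by case/exists_inP: N0; exists v.
Qed.

Let sum_share_length j l :
  \sum_(v | job_of v == j) (if v \in A l then share (A l) v else 0) * d l = weight j * dj j l.
Proof. by rewrite -mulr_suml sum_share /dj; case: ifP; rewrite ?mul0r ?mulr0. Qed.

Let sum_jobs (F : task I -> R) : \sum_v F v = \sum_j \sum_(v | job_of v == j) F v.
Proof. exact: (partition_big (@job_of R I) xpredT). Qed.

Lemma alive_weight_jobs l : W l * d l = \sum_j weight j * dj j l.
Proof.
rewrite /W mulr_suml big_mkcond /= sum_jobs; apply: eq_bigr => j _.
by rewrite -sum_share_length; apply: eq_bigr => v _; case: ifP; rewrite ?mul0r.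
Qed.

(** Single shares grow when sibling tasks finish, so the comparison is made per job, where the
    shares of an active job always total its weight. *)
Lemma alive_weight_antitone k l : (k <= l)%N -> W l <= W k.
Proof.
move=> kl; rewrite /W big_mkcond [leRHS]big_mkcond /= !sum_jobs.
apply: ler_sum => j _; rewrite !sum_share; case: ifP => [/exists_inP[v vA vj]|_].
  suff -> : active j k by [].
  by apply/exists_inP; exists v => //; apply: (fintype.subsetP (A_antitone kl)).
by case: ifP => // _; exact: weight_ge0.
Qed.

Lemma alive_weight_ge0 l : 0 <= W l.
Proof. by rewrite sumr_ge0// => v _; exact: share_ge0. Qed.

Let sum_charge : \sum_l W l * d l <= 2 * \sum_v \sum_l charge v l.
Proof.
rewrite (eq_bigr _ (fun l _ => alive_weight_jobs l)) exchange_big /= sum_jobs mulr_sumr.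
apply: ler_sum => j _; rewrite exchange_big /= -mulr_sumr.
rewrite [X in _ <= 2 * X](eq_bigr (fun l => weight j * (dj j l * (elapsed j l / class_length j l)))); last first.
  move=> l _; rewrite mulrA -sum_share_length mulr_suml.
  by apply: eq_bigr => v /eqP <-.
rewrite -mulr_sumr mulrCA ler_wpM2l ?weight_ge0//.
exact: sum_le_twice_prefix.
Qed.

Let share_le_weight v l : v \in A l -> share (A l) v <= W l.
Proof.
move=> vA; rewrite /W (bigD1 v)//= lerDl sumr_ge0// => u _; exact: share_ge0.
Qed.

Let class_le_rate v l : v \in A l -> 0 < W l -> class (job_of v) l <= rate 1 (A l) v.
Proof.
move=> vA W0; rewrite /class.
elim/big_ind: _ => [||i good]; first exact: rate_ge0.
  by move=> x y hx hy; rewrite ge_max hx hy.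
have := rate_lower_bound (@ler01 R) i vA; rewrite !mul1r min_l//.
by rewrite mulrC ler_pM2l.
Qed.

(** A task alive on [l] was alive on all earlier pieces, and on those of the same class it ran at
    least at the class speed. *)
Let class_elapsed_le v l : v \in A l -> 0 < W l ->
  class (job_of v) l * elapsed (job_of v) l <= requirement v.
Proof.
move=> vA W0; apply: le_trans (processed_le v).
rewrite mulr_sumr big_mkcond [leRHS]big_mkcond /=; apply: ler_sum => k _.
have r0 := rate_ge0 1 (A k) v.
case: ifPn => [/andP[/eqP ck kl]|_]; last by case: ifP => // _; rewrite mulr_ge0.
have vk : v \in A k by apply: (fintype.subsetP (A_antitone kl)).
have Wk : 0 < W k by rewrite (lt_le_trans W0)// alive_weight_antitone.
rewrite vk -ck ler_pM//; first exact: class_le_rate.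
by rewrite /dj; case: ifP.
Qed.

(** Isolates the degenerate pieces of alive weight 0, where the rate bound is empty but all charges
    vanish. *)
Let share_gt0_weight v l : v \in A l -> share (A l) v = 0 \/ 0 < W l.
Proof.
move=> vA; have [|] := eqVneq (share (A l) v) 0; first by left.
move=> s0; right; apply: lt_le_trans (share_le_weight vA).
by rewrite lt0r s0 share_ge0.
Qed.

Let eta_ge0 v : 0 <= eta v.
Proof.
rewrite divr_ge0 ?requirement_ge0// sumr_ge0// => l _.
by rewrite mulr_ge0 ?charge_ge0.
Qed.

(** The additional class is the value 0, taken when no machine meets the threshold. *)
Let classes j : (size (undup (codom (class j))) <= (num_speeds I).+1)%N.
Proof.
rewrite (_ : (num_speeds I).+1 = size (0 :: undup (codom (@speed R I))))//.
apply: uniq_leq_size; first exact: undup_uniq.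
move=> x; rewrite mem_undup => /codomP[l ->]; rewrite inE mem_undup.
rewrite /class; elim/big_ind: _ => [|y z hy hz|i _]; first by rewrite eqxx.
  by rewrite /Num.max; case: ifP.
by rewrite codom_f orbT.
Qed.

(** By [class_elapsed_le] the division in [eta] costs nothing; what remains is [weight j] times
    length over class length, at most [weight j] per class. *)
Let sum_eta j : \sum_(v | job_of v == j) eta v <= (K + 1) * weight j.
Proof.
have cD l : 0 <= class_length j l by rewrite sumr_ge0.
apply: (@le_trans _ _ (\sum_(v | job_of v == j)
    \sum_l (if v \in A l then share (A l) v else 0) * d l / class_length j l)).
  apply: ler_sum => v /eqP vj; rewrite /eta mulr_suml; apply: ler_sum => l _.
  rewrite /charge vj; case: ifP => [vA|_]; last by rewrite !mul0r mulr0 mul0r.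
  have [->|W0] := share_gt0_weight vA; first by rewrite !mul0r mulr0 mul0r.
  have := class_elapsed_le vA W0; rewrite vj => h.
  rewrite [leLHS](_ : _ = share (A l) v * d l / class_length j l *
    (class j l * elapsed j l / requirement v)); last by ring.
  apply: ler_piMr; first by apply: divr_ge0 => //; rewrite mulr_ge0 ?share_ge0.
  by rewrite ler_pdivrMr ?mul1r// (A_requirement vA).
rewrite exchange_big /=.
rewrite (eq_bigr (fun l => weight j * (dj j l / class_length j l))); last first.
  by move=> l _; rewrite -mulr_suml sum_share_length mulrA.
rewrite -mulr_sumr mulrC ler_wpM2r ?weight_ge0//.
have h : \sum_l dj j l / class_length j l <= (size (undup (codom (class j))))%:R.
  exact: sum_div_class_le.
apply: le_trans h _.
by rewrite natr1 ler_nat.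
Qed.

Let multiplicity_gt0 i : (0 < multiplicity i)%N.
Proof. by apply/card_gt0P; exists i; rewrite inE. Qed.

(** Pieces whose class is at least [speed i] are paid by [eta v]. On the others the charge at speed
    [speed i] is at most the work of the algorithm on [v] times the machine price, and that work
    totals at most [requirement v]. *)
Let dual_feasible i v k :
  speed i * (\sum_(l : 'I_N | (k <= l)%N) charge v l) <=
    requirement v * (W k / (multiplicity i)%:R + (if v \in A k then eta v else 0)).
Proof.
have Wm : 0 <= W k / (multiplicity i)%:R by rewrite divr_ge0// alive_weight_ge0.
case: ifPn => [vk|vk]; last first.
  rewrite big1 => [|l kl]; first by rewrite mulr0 addr0 mulr_ge0 ?requirement_ge0.
  rewrite /charge ifN ?mul0r//; apply: contra vk.
  by apply/fintype.subsetP; exact: A_antitone.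
rewrite mulrDr /eta [X in _ <= _ + X]mulrCA divff ?mulr1 ?gt_eqF ?(A_requirement vk)//.
apply: (@le_trans _ _ (\sum_(l : 'I_N | (k <= l)%N)
   ((if v \in A l then rate 1 (A l) v * d l * (W k / (multiplicity i)%:R) else 0)
     + class (job_of v) l * charge v l))).
  rewrite mulr_sumr; apply: ler_sum => l kl.
  have [slow|fast] := leP (speed i) (class (job_of v) l).
    rewrite ler_wpDl// ?ler_wpM2r//.
    by case: ifP => // _; rewrite !mulr_ge0// ?rate_ge0// ?invr_ge0 ?alive_weight_ge0.
  apply: ler_wpDr; first exact: mulr_ge0.
  apply: le_trans (ler_wpM2l (ltW (speed_gt0 i)) (charge_le v l)) _.
  case: ifPn => [vl|_]; last by rewrite mul0r mulr0.
  have m0 : (0 : R) < (multiplicity i)%:R by rewrite ltr0n.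
  rewrite [leLHS]mulrA [leRHS](_ : _ = rate 1 (A l) v * W k / (multiplicity i)%:R * d l); last by ring.
  rewrite ler_wpM2r// ler_pdivlMr// -mulrA.
  (* The class is the maximal speed meeting the threshold, so a faster machine misses it. *)
  have bad : share (A l) v * (multiplicity i)%:R < W l.
    rewrite ltNge; apply/negP => good; move: fast; rewrite ltNge => /negP; apply.
    by rewrite /class (bigD1 i)//= le_max lexx.
  have := rate_lower_bound (@ler01 R) i vl; rewrite !mul1r min_r ?(ltW bad)//.
  move=> /le_trans; apply; rewrite mulrC ler_wpM2l ?rate_ge0//.
  exact: alive_weight_antitone.
rewrite big_split /=; apply: lerD.
  rewrite -big_mkcondr/= -mulr_suml ler_wpM2r//; apply: le_trans (processed_le v).
  rewrite big_mkcond [leRHS]big_mkcond /=; apply: ler_sum => l _.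
  case: (v \in A l); last by rewrite andbF.
  by rewrite andbT; case: ifP => // _; rewrite mulr_ge0 ?rate_ge0.
rewrite big_mkcond /=; apply: ler_sum => l _; case: ifP => // _.
exact: mulr_ge0.
Qed.

(* z i v l is the time that the adversary's machine i spends on task v during
   the time corresponding to piece l, compressed by the factor gam, and c j is
   the adversary's completion time of job j. *)
Variables (z : 'I_(machines I) -> task I -> 'I_N -> R) (c : job I -> R) (gam : R).
Hypothesis gam_gt0 : 0 < gam.
Hypothesis z_ge0 : forall i v l, 0 <= z i v l.
Hypothesis z_machine : forall i l, \sum_v z i v l <= d l / gam.
Hypothesis z_task : forall v l, \sum_i z i v l <= d l / gam.
Hypothesis c_ge0 : forall j, 0 <= c j.
Hypothesis c_done : forall v l, 0 < weight (job_of v) -> v \in A l ->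
  gam * c (job_of v) < \sum_(k : 'I_N | (k <= l)%N) d k ->
  requirement v <= \sum_(k : 'I_N | (k <= l)%N) \sum_i speed i * z i v k.

(** All selected pieces lie in the prefix of the last selected one. *)
Let sum_prefix_le (x : R) : 0 <= x ->
  \sum_(l : 'I_N | \sum_(k : 'I_N | (k <= l)%N) d k <= x) d l <= x.
Proof.
pose P (l : 'I_N) := \sum_(k : 'I_N | (k <= l)%N) d k <= x.
move=> x0; rewrite -/(\sum_(l | P l) d l).
have [/existsP[l0 Pl0]|/existsPn N0] := boolP [exists l, P l]; last first.
  by rewrite big_pred0// => l; apply/negbTE.
case: (@arg_maxnP _ l0 P (fun l => val l) Pl0) => l Pl lmax.
apply: le_trans Pl; rewrite big_mkcond [leRHS]big_mkcond /=; apply: ler_sum => k _.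
by case: ifP => [/lmax /= -> //|_]; case: ifP.
Qed.

Let sum_eta_alive : \sum_v \sum_k (if v \in A k then eta v else 0) * d k <=
  (K + 1) * \sum_k W k * d k.
Proof.
rewrite exchange_big mulr_sumr; apply: ler_sum => k _ /=.
rewrite alive_weight_jobs mulr_sumr sum_jobs; apply: ler_sum => j _.
apply: (@le_trans _ _ (\sum_(v | job_of v == j) eta v * dj j k)).
  apply: ler_sum => v vj; rewrite /dj; case: ifP => vA; last by rewrite mul0r mulr_ge0// -/(dj j k).
  by rewrite ifT//; apply/exists_inP; exists v.
by rewrite -mulr_suml mulrA ler_wpM2r// sum_eta.
Qed.

Let sum_inv_multiplicity : \sum_(i < machines I) (multiplicity i)%:R^-1 <= K :> R.
Proof.
have := sum_div_class_le (@speed R I) (fun=> 1 : R).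
apply: le_trans; apply: ler_sum => i _.
rewrite div1r /multiplicity -sum1_card natr_sum.
by rewrite (eq_bigl (fun k : 'I_(machines I) => speed k == speed i)) => [|k]; rewrite ?inE.
Qed.

(** The alive weight occurs on both sides so that a large [gam] can absorb it. Charges up to the
    stretched time [gam * c j] give the first term. Later the adversary has finished the task, so a
    charge may be multiplied by its work over the requirement; [dual_feasible] turns this into
    prices, where machines account for [K / gam] and tasks for [(K + 1) / gam]. *)
Lemma dual_fitting : \sum_l W l * d l <=
  2 * (gam * (\sum_j weight j * c j) + (2 * K + 1) / gam * \sum_l W l * d l).
Proof.
apply: le_trans sum_charge _; rewrite ler_pM2l//.
pose X v l := \sum_(k : 'I_N | (k <= l)%N) \sum_i speed i * z i v k.
pose late j l := \sum_(k : 'I_N | (k <= l)%N) d k <= gam * c j.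
have s0 i := ltW (@speed_gt0 R I i).
have X0 v l : 0 <= X v l by apply: sumr_ge0 => k _; apply: sumr_ge0 => i _; rewrite mulr_ge0.
have split v l : charge v l <=
    (if late (job_of v) l then (if v \in A l then share (A l) v else 0) * d l else 0)
    + charge v l * X v l / requirement v.
  have r0 := @requirement_ge0 R I v.
  case: ifPn => [_|]; first by rewrite ler_wpDr ?charge_le// divr_ge0// mulr_ge0.
  rewrite -ltNge add0r => done; case: (boolP (v \in A l)) => vA; last first.
    by rewrite /charge (negbTE vA) !mul0r.
  have := @weight_ge0 R I (job_of v); rewrite le_eqVlt => /orP[/eqP w0|w0].
    by rewrite /charge /share -w0 !mul0r if_same !mul0r.
  rewrite -mulrA ler_peMr// ler_pdivlMr ?mul1r ?(A_requirement vA)//.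
  exact: c_done.
apply: le_trans (ler_sum _ (fun v _ => ler_sum _ (fun l _ => split v l))) _.
rewrite (eq_bigr _ (fun v _ => big_split _ _ _ _ _)) big_split /=; apply: lerD.
  rewrite sum_jobs mulr_sumr; apply: ler_sum => j _; rewrite exchange_big /=.
  apply: (@le_trans _ _ (\sum_(l | late j l) weight j * d l)).
    rewrite [leRHS]big_mkcond /=; apply: ler_sum => l _.
    rewrite (eq_bigr (fun v => if late j l then (if v \in A l then share (A l) v else 0) * d l else 0)); last by move=> v /eqP ->.
    case: ifP => _; last by rewrite big1.
    rewrite sum_share_length ler_wpM2l ?weight_ge0// /dj; by case: ifP.
  rewrite -mulr_sumr mulrCA ler_wpM2l ?weight_ge0//.
  by apply: sum_prefix_le; rewrite mulr_ge0// ltW.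
apply: (@le_trans _ _ (\sum_v \sum_k \sum_i z i v k *
    (W k / (multiplicity i)%:R + (if v \in A k then eta v else 0)))).
  apply: ler_sum => v _; rewrite -mulr_suml.
  have := @requirement_ge0 R I v; rewrite le_eqVlt => /orP[/eqP r0|r0].
    rewrite -r0 invr0 mulr0 sumr_ge0// => k _; rewrite sumr_ge0// => i _.
    rewrite mulr_ge0// addr_ge0 ?divr_ge0 ?alive_weight_ge0//.
    by case: ifP.
  rewrite ler_pdivrMr// (eq_bigr _ (fun l _ => mulr_sumr _ _ _ _)).
  (* The swap attributes to the work done on piece [k] all charges on pieces [l >= k]. *)
  rewrite (exchange_big_dep xpredT)//= mulr_suml; apply: ler_sum => k _.
  rewrite -mulr_suml mulr_sumr mulr_suml; apply: ler_sum => i _.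
  set C := \sum_(_ | _) charge v _; set Y := W k / _ + _.
  rewrite [leLHS](_ : _ = z i v k * (speed i * C)); last by ring.
  by rewrite -mulrA (mulrC Y) ler_wpM2l// dual_feasible.
rewrite (_ : 2 * K + 1 = K + (K + 1)); last by ring.
rewrite !mulrDl [leLHS](_ : _ =
    \sum_v \sum_k \sum_i z i v k * (W k / (multiplicity i)%:R) +
    \sum_v \sum_k \sum_i z i v k * (if v \in A k then eta v else 0)); last first.
  rewrite -big_split; apply: eq_bigr => v _ /=; rewrite -big_split; apply: eq_bigr => k _ /=.
  by rewrite -big_split; apply: eq_bigr => i _ /=; rewrite mulrDr.
apply: lerD.
  rewrite exchange_big /= mulr_sumr; apply: ler_sum => k _.
  rewrite exchange_big /=; under eq_bigr do rewrite -mulr_suml.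
  apply: (@le_trans _ _ (\sum_(i < machines I) d k / gam * (W k / (multiplicity i)%:R))).
    apply: ler_sum => i _; rewrite ler_wpM2r ?z_machine//.
    by rewrite divr_ge0 ?alive_weight_ge0.
  under eq_bigr do rewrite mulrA.
  rewrite -mulr_sumr mulrC [leRHS](_ : _ = K * (d k / gam * W k)); last by ring.
  rewrite ler_wpM2r//.
  by rewrite mulr_ge0 ?alive_weight_ge0// divr_ge0// ltW.
rewrite -mulrDl [leRHS](_ : _ = gam^-1 * ((K + 1) * \sum_l W l * d l)); last by ring.
apply: (@le_trans _ _ (gam^-1 * \sum_v \sum_k (if v \in A k then eta v else 0) * d k)); last first.
  by rewrite ler_wpM2l ?sum_eta_alive// invr_ge0 ltW.
rewrite mulr_sumr; apply: ler_sum => v _; rewrite mulr_sumr; apply: ler_sum => k _.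
rewrite -mulr_suml mulrC [leRHS](_ : _ = (if v \in A k then eta v else 0) * (d k / gam)); last by ring.
by rewrite ler_wpM2l//; case: ifP.
Qed.
End DualFitting.
(** * Machine time used by the adversary *)

Lemma sum_measure_le (d : measure_display) (X : measurableType d) (R : realType)
    (mu : {measure set X -> \bar R}) (T : finType) (F : T -> set X) (D : set X) :
  (forall t, measurable (F t)) -> measurable D -> (forall t, F t `<=` D) ->
  (forall s t x, F s x -> F t x -> s = t) ->
  (\sum_t mu (F t) <= mu D)%E.
Proof.
move=> mF mD FD inj.
have -> : (\sum_t mu (F t) = \sum_(t \in [set: T]) mu (F t))%E.
  rewrite (_ : [set: T] = [set` enum T]); last first.
    by apply/seteqP; split => t //= _; rewrite mem_enum.
  by rewrite -fsbig_seq ?enum_uniq// big_enum.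
rewrite -measure_fin_bigcup//; last 2 first.
- exact: finite_finset.
- by apply/trivIsetP => s t _ _ /eqP st; rewrite -subset0 => x [/inj h /h].
apply: le_measure; rewrite ?inE//; first by apply: fin_bigcup_measurable => //; exact: finite_finset.
by move=> x [t _ /FD].
Qed.

(** The integral is a supremum over simple functions below the integrand. This form serves before
    the rates of a run are known to be measurable, a fact that itself rests on the monotonicity of
    the run. *)
Lemma ge0_integral_subset_le (d : measure_display) (X : measurableType d) (R : realType)
    (mu : {measure set X -> \bar R}) (D E : set X) (f : X -> \bar R) :
  (forall x, (0 <= f x)%E) -> D `<=` E ->
  (\int[mu]_(x in D) f x <= \int[mu]_(x in E) f x)%E.
Proof.
move=> f0 DE; have g0 (B : set X) x : (0 <= (f \_ B) x)%E by rewrite /patch; case: ifP.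
rewrite integral_mkcond [leRHS]integral_mkcond !ge0_integralTE//.
apply: ereal_sup_le => _ [h hle <-]; exists h => // x.
apply: le_trans (hle x) _; rewrite /patch; case: ifPn => [xD|_]; last by case: ifP.
by rewrite ifT// inE; apply: DE; rewrite inE in xD.
Qed.

Section Schedule.
Variables (R : realType) (I : instance R).
Variable sigma : 'I_(machines I) -> R -> option (task I).
Hypothesis sigma_schedule : is_schedule sigma.
Implicit Types (v : task I) (i : 'I_(machines I)) (t : R).

Definition busy i v t : R :=
  fine (lebesgue_measure ([set u | sigma i u = Some v] `&` `[0, t])).

Let busy_set i v t t' := [set u | sigma i u = Some v] `&` `]t, t'].

Let busy_set_measurable i v t t' : measurable (busy_set i v t t').
Proof. by apply: measurableI => //; exact: sigma_schedule.1. Qed.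

Let itv_measure t t' : t <= t' -> lebesgue_measure (`]t, t'] : set R) = (t' - t)%:E.
Proof.
rewrite lebesgue_measure_itv /= lte_fin le_eqVlt => /orP[/eqP ->|->//].
by rewrite ltxx subrr.
Qed.

Let busy_increment i v t t' : 0 <= t -> t <= t' ->
  (busy i v t' - busy i v t)%:E = lebesgue_measure (busy_set i v t t').
Proof.
move=> t0 tt'.
have mE s : measurable ([set u | sigma i u = Some v] `&` `[0, s]).
  by apply: measurableI => //; exact: sigma_schedule.1.
have fin s : (lebesgue_measure ([set u | sigma i u = Some v] `&` `[0%R, s]) < +oo)%E.
  apply: (@le_lt_trans _ _ (lebesgue_measure (`[0, s] : set R))).
    by apply: le_measure; rewrite ?inE//; exact: mE.
  by rewrite lebesgue_measure_itv /=; case: ifP => _; rewrite -?EFinB ltry.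
have fin' s : lebesgue_measure ([set u | sigma i u = Some v] `&` `[0%R, s]) \is a fin_num.
  by rewrite ge0_fin_numE.
have e : (lebesgue_measure ([set u | sigma i u = Some v] `&` `[0%R, t']) =
    lebesgue_measure ([set u | sigma i u = Some v] `&` `[0%R, t]) +
    lebesgue_measure (busy_set i v t t'))%E.
  rewrite (_ : _ `&` `[0, t'] =
    ([set u | sigma i u = Some v] `&` `[0, t]) `|` busy_set i v t t').
    apply: measureU; [exact: mE|exact: busy_set_measurable|].
    rewrite -subset0 => u [[_ /=] + [_ /=]]; rewrite !in_itv/= => /andP[_ ut] /andP[tu _].
    by move: tu; rewrite ltNge ut.
  by rewrite -setIUr; congr (_ `&` _); rewrite -itv_bndbnd_setU// ?bnd_simp.
by rewrite EFinB /busy !fineK// e addeC addeA (addeC (- _)%E) subee// add0e.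
Qed.

Lemma busy0 i v : busy i v 0 = 0.
Proof.
rewrite /busy (_ : lebesgue_measure _ = 0%E)//; apply/le_anti/andP; split => //.
apply: (@le_trans _ _ (lebesgue_measure (`[0, 0] : set R))).
  apply: le_measure; rewrite ?inE//; by apply: measurableI => //; exact: sigma_schedule.1.
by rewrite lebesgue_measure_itv /= ltxx.
Qed.

Lemma busy_le i v t t' : 0 <= t -> t <= t' -> busy i v t <= busy i v t'.
Proof. by move=> t0 tt'; rewrite -subr_ge0 -lee_fin busy_increment. Qed.

Lemma sum_busy_machine i t t' : 0 <= t -> t <= t' ->
  \sum_v (busy i v t' - busy i v t) <= t' - t.
Proof.
move=> t0 tt'; rewrite -lee_fin -sumEFin -itv_measure//.
under eq_bigr do rewrite busy_increment//.
apply: sum_measure_le => [v|//|v u []//|v w u [/= sv _] [/= sw _]].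
  exact: busy_set_measurable.
by move: sw; rewrite sv => -[].
Qed.

Lemma sum_busy_task v t t' : 0 <= t -> t <= t' ->
  \sum_i (busy i v t' - busy i v t) <= t' - t.
Proof.
move=> t0 tt'; rewrite -lee_fin -sumEFin -itv_measure//.
under eq_bigr do rewrite busy_increment//.
apply: sum_measure_le => [i|//|i u []//|i k u [/= + _] [/= + _]].
  exact: busy_set_measurable.
exact: sigma_schedule.2.
Qed.

End Schedule.
(** * The trajectory of the algorithm *)

Lemma sum_ord_prefix (R : zmodType) (N : nat) (b : nat -> R) (l : 'I_N) :
  \sum_(k : 'I_N | (k <= l)%N) (b k.+1 - b k) = b l.+1 - b 0%N.
Proof.
rewrite -(big_ord_widen N (fun k => b k.+1 - b k) (ltn_ord l)).
by rewrite -(big_mkord xpredT (fun k => b k.+1 - b k)) telescope_sumr.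
Qed.

Section Completion.
Variables (R : realType) (I : instance R) (y : task I -> R -> R) (j : job I).

Definition completed (u : R) : Prop := forall v, job_of v = j -> requirement v <= y v u.

Lemma completion_time_le u : 0 <= u -> completed u -> (completion_time y j <= u%:E)%E.
Proof. by move=> u0 cu; apply: ereal_inf_lbound; exists u. Qed.

Lemma completion_time_lt u : (completion_time y j < u%:E)%E ->
  exists2 s, 0 <= s < u & completed s.
Proof.
move=> /ereal_inf_lt[_ [s [s0 cs] <-]]; rewrite lte_fin => su.
by exists s; rewrite ?s0.
Qed.

Lemma completion_time_ge0 : (0 <= completion_time y j)%E.
Proof. by apply/ereal_infP => _ [s [s0 _] <-]; rewrite lee_fin. Qed.

End Completion.

Lemma num_speeds_gt0 (R : realType) (I : instance R) : (0 < num_speeds I)%N.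
Proof.
rewrite /num_speeds -has_predT; apply/hasP.
exists (speed (Ordinal (machines_gt0 I))) => //.
by rewrite mem_undup codom_f.
Qed.

Section Run.
Variables (R : realType) (I : instance R) (y : task I -> R -> R).
Hypothesis y_run : is_run 1 y.
Implicit Types (v : task I) (j : job I) (s t u T : R) (B : {set task I}).

Let rate_at v u : R := rate 1 (alive y u) v.

Let run_le v s t : 0 <= s -> s <= t -> y v s <= y v t.
Proof.
move=> s0 st; rewrite -lee_fin !y_run ?(le_trans s0)//.
apply: ge0_integral_subset_le => [u|]; first by rewrite lee_fin rate_ge0.
by apply: subset_itvl; rewrite bnd_simp.
Qed.

Let run_ge0 v t : 0 <= t -> 0 <= y v t.
Proof.
by move=> t0; rewrite -lee_fin y_run// integral_ge0// => u _; rewrite lee_fin rate_ge0.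
Qed.

Let alive_antitone s t : 0 <= s -> s <= t -> alive y t \subset alive y s.
Proof.
move=> s0 st; apply/fintype.subsetP => v; rewrite !inE; apply: le_lt_trans.
exact: run_le.
Qed.

(** The alive set takes finitely many values and only shrinks, so each value is taken on an
    interval. *)
Let rate_at_measurable v : measurable_fun (`[0, +oo[ : set R) (rate_at v).
Proof.
move=> _ Y _; rewrite (_ : _ `&` _ = \bigcup_(B in [set B | Y (rate 1 B v)])
   (`[0, +oo[ `&` [set u | alive y u = B])); last first.
  apply/seteqP; split => u /=; first by move=> [u0 Yu]; exists (alive y u).
  by move=> [B YB [u0 uB]]; split => //; rewrite /rate_at uB.
apply: fin_bigcup_measurable => [|B _]; first exact: finite_finset.
apply: is_interval_measurable => a c [/=]; rewrite !in_itv/= !andbT => a0 aB [_ cB].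
move=> u /andP[au uc]; split => /=; first by rewrite in_itv/= andbT (le_trans a0).
apply/eqP; rewrite finset.eqEsubset -{1}aB -cB !alive_antitone//.
by rewrite (le_trans a0).
Qed.

(** Stated for the open interval because the alive set is controlled only strictly between
    breakpoints. *)
Let run_step v B s t : 0 <= s -> s <= t -> (forall u, s < u < t -> alive y u = B) ->
  y v s + rate 1 B v * (t - s) <= y v t.
Proof.
move=> s0; rewrite le_eqVlt => /orP[/eqP <- _|st AB]; first by rewrite subrr mulr0 addr0.
have t0 : 0 <= t by rewrite (le_trans s0)// ltW.
rewrite -lee_fin EFinD !y_run//.
have -> : (rate 1 B v * (t - s))%:E =
    (\int[lebesgue_measure]_(u in `]s, t[) (rate 1 (alive y u) v)%:E)%E.
  rewrite (eq_integral (cst (rate 1 B v)%:E)) => [|u].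
    by rewrite integral_cst//= lebesgue_measure_itv/= lte_fin st EFinM.
  by rewrite inE/= in_itv/= => /AB ->.
have m (D : set R) : D `<=` `[0, +oo[ -> measurable D ->
    measurable_fun D (fun u => (rate 1 (alive y u) v)%:E).
  by move=> D0 mD; apply/measurable_EFinP; apply: measurable_funS (rate_at_measurable v).
rewrite -ge0_integral_setU//; last 3 first.
- apply: m; last exact: measurableU.
  by move=> u [|]/=; rewrite !in_itv/= andbT => /andP[]// /ltW su _; exact: le_trans su.
- by move=> u _; rewrite lee_fin rate_ge0.
- apply/disj_setPLR => u /=; rewrite !in_itv/= => /andP[_ us]; apply/negP.
  by rewrite negb_and -leNgt us.
apply: ge0_integral_subset_le => [u|u]; first by rewrite lee_fin rate_ge0.
case=> /=; rewrite !in_itv/= => /andP[].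
  by move=> -> us; rewrite (le_trans us)// ltW.
by move=> su ut; rewrite (le_trans s0) ltW.
Qed.

(** * Pieces of constant alive set up to a finite horizon *)

Section Horizon.
Variable T : R.
Hypothesis T_ge0 : 0 <= T.

Let n := num_tasks I.

(* Until time b l more than n - l tasks are alive, and after it at most n - l. *)
Let before l : set R := [set u | 0 <= u <= T /\ (u = 0 \/ (n < #|alive y u| + l)%N)].
Definition breakpoint l : R := sup (before l).
Local Notation b := breakpoint.

Let before_sup l : has_sup (before l).
Proof. by split; [exists 0; split; [rewrite lexx|left]|exists T => u [/andP[]]]. Qed.

Let b_ub l u : before l u -> u <= b l.
Proof. by apply: ub_le_sup; case: (before_sup l). Qed.

(** More than [n] tasks cannot be alive, so only the default member 0 remains. *)
Lemma breakpoint0 : b 0 = 0.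
Proof.
rewrite /breakpoint (_ : before 0 = [set 0]) ?sup1//.
apply/seteqP; split => u /=; last by move=> ->; split; [rewrite lexx|left].
by move=> [_ [//|]]; rewrite addn0 ltnNge max_card.
Qed.

(** At index [n.+1] the cardinality condition is void, hence [n.+1] pieces cover the horizon. *)
Lemma breakpoint_last : b n.+1 = T.
Proof.
apply/le_anti/andP; split; first by apply: ge_sup; [case: (before_sup n.+1)|move=> u [/andP[]]].
by apply: b_ub; split; [rewrite T_ge0 lexx|right; rewrite addnS ltnS leq_addl].
Qed.

Lemma breakpoint_le k l : (k <= l)%N -> b k <= b l.
Proof.
move=> kl; apply: ge_sup; first by case: (before_sup k).
move=> u [u0 h]; apply: b_ub; split => //; case: h => [|h]; first by left.
by right; apply: leq_trans h _; rewrite leq_add2l.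
Qed.

Lemma breakpoint_ge0 l : 0 <= b l.
Proof. by rewrite -breakpoint0 breakpoint_le. Qed.

(** The midpoint samples the interior of the piece; for an empty piece the value is harmless, the
    length being 0. *)
Definition piece l : {set task I} := alive y ((b l + b l.+1) / 2).

Let d l := b l.+1 - b l.

Let d_ge0 l : 0 <= d l.
Proof. by rewrite subr_ge0 breakpoint_le. Qed.

Let card_alive l u : b l < u < b l.+1 -> (#|alive y u| + l = n)%N.
Proof.
move=> /andP[lu ul]; have u0 := le_lt_trans (breakpoint_ge0 l) lu.
have e0 : 0 < b l.+1 - u by rewrite subr_gt0.
have [u' [/andP[u'0 u'T] h]] := sup_adherent e0 (before_sup l.+1).
rewrite -/(b l.+1) subKr => uu'.
apply/eqP; rewrite eqn_leq; apply/andP; split.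
  rewrite leqNgt; apply/negP => nl; have : u <= b l.
    by apply: b_ub; split; [rewrite ltW//= (le_trans (ltW uu'))|right].
  by rewrite leNgt lu.
case: h => [u'E|]; first by move: uu'; rewrite u'E ltNge ltW.
rewrite addnS ltnS => /leq_trans; apply; rewrite leq_add2r.
by apply/subset_leq_card/alive_antitone; exact: ltW.
Qed.

(** Alive sets are nested, and inside a piece they have equal cardinality. *)
Lemma piece_alive l u : b l < u < b l.+1 -> alive y u = piece l.
Proof.
move=> ulu; have /andP[lu ul] := ulu; rewrite /piece; set m := _ / 2.
have m_itv : b l < m < b l.+1 by rewrite /m; lra.
have /eqP := card_alive m_itv; rewrite -(card_alive ulu) eqn_add2r => /eqP e.
have b0 := breakpoint_ge0 l.
have [um|mu] := leP u m; last symmetry; apply/eqP; rewrite eq_sym eqEcard e leqnn andbT.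
  by rewrite alive_antitone// ltW// (le_lt_trans b0).
rewrite alive_antitone//; [lra|exact: ltW].
Qed.

Lemma piece_antitone k l : (k <= l)%N -> piece l \subset piece k.
Proof.
move=> kl; apply: alive_antitone.
  by have := breakpoint_ge0 k; have := breakpoint_ge0 k.+1; lra.
have := breakpoint_le kl; have : b k.+1 <= b l.+1 by rewrite breakpoint_le.
lra.
Qed.

Let piece_requirement v l : v \in piece l -> 0 < requirement v.
Proof.
rewrite inE; apply: le_lt_trans; apply: run_ge0.
by have := breakpoint_ge0 l; have := breakpoint_ge0 l.+1; lra.
Qed.

(** The bound by [y] carries the induction. The bound by the requirement comes from stopping just
    before the end of the piece, where [v] is still alive. *)
Let processed v (k : nat) :
  let S := \sum_(l < k | v \in piece l) rate 1 (piece l) v * d l in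
  S <= requirement v /\ S <= y v (b k).
Proof.
elim: k => [|k [ih1 ih2]] /=.
  by rewrite big_ord0 requirement_ge0 run_ge0 ?breakpoint_ge0.
rewrite big_mkcond big_ord_recr /= -big_mkcond /=.
set S := \sum_(_ < _ | _) _ in ih1 ih2 *.
have b0 := breakpoint_ge0 k; have bk := breakpoint_le (leqnSn k).
case: ifPn => [vk|_]; last by rewrite addr0; split => //; apply: le_trans ih2 _; exact: run_le.
set r := rate _ _ _; have r0 : 0 <= r by exact: rate_ge0.
split; last first.
  apply: le_trans (run_step v b0 bk (@piece_alive k)); by rewrite lerD2r.
apply/ler_addgt0Pr => e e0.
have [d0|dn0] := eqVneq (d k) 0; first by rewrite d0 mulr0 addr0 (le_trans ih1)// lerDl ltW.
have dp : 0 < d k by rewrite lt0r dn0 d_ge0.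
(* [x] stays inside the piece and forfeits at most [e] units of work; [r + 1] avoids division by
   0. *)
pose x := Num.min (d k / 2) (e / (r + 1)).
have xd : x <= d k / 2 by rewrite ge_min lexx.
have xe : x <= e / (r + 1) by rewrite ge_min lexx orbT.
have x0 : 0 < x by rewrite lt_min !divr_gt0// ltr_wpDl.
have uk : b k < b k.+1 - x < b k.+1 by move: dp xd x0; rewrite /d; lra.
have h : y v (b k) + r * (b k.+1 - x - b k) <= y v (b k.+1 - x).
  apply: run_step => // [|u /andP[ku ux]]; first by case/andP: uk => /ltW.
  by apply: piece_alive; rewrite ku /= (lt_trans ux)//; case/andP: uk.
have : v \in alive y (b k.+1 - x) by rewrite (piece_alive uk).
rewrite inE => h'.
have rx : r * x <= e.
  apply: (@le_trans _ _ ((r + 1) * (e / (r + 1)))); last by rewrite mulrC divfK ?gt_eqF// ltr_wpDl.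
  by rewrite ler_pM// ?ltW// ltrDl.
rewrite /d; move: h ih2 h' rx; rewrite !mulrBr; lra.
Qed.

Let N := n.+1.
Let A (l : 'I_N) := piece l.
Let dl (l : 'I_N) := d l.

(** Truncating the pieces at [t] partitions [[0, t]]. Every nonempty truncated piece contains a time
    at which [j] is unfinished, so [j] is active there. *)
Let le_sum_active_length j t : t <= T ->
  (forall u, 0 <= u < t -> ~ completed y j u) ->
  t <= \sum_l active_length A dl j l.
Proof.
move=> tT unfinished; have [t0|t0] := ltP t 0.
  by apply: le_trans (ltW t0) _; rewrite sumr_ge0// => l _; rewrite /active_length; case: ifP => // _; exact: d_ge0.
apply: (@le_trans _ _ (\sum_(l < N) (Num.min (b l.+1) t - Num.min (b l) t))).
  rewrite -(big_mkord xpredT (fun l => Num.min (b l.+1) t - Num.min (b l) t)).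
  by rewrite telescope_sumr// breakpoint_last breakpoint0 (min_r tT) min_l// subr0.
apply: ler_sum => l _; have bl := breakpoint_le (leqnSn l); have b0 := breakpoint_ge0 l.
have act0 : 0 <= active_length A dl j l.
  by rewrite /active_length; case: ifP => // _; exact: d_ge0.
have [tb|bt] := leP t (b l).
  by rewrite (min_r (le_trans tb bl)) subrr.
have [e|ne] := eqVneq (b l) (b l.+1); first by rewrite -e (min_l (ltW bt)) subrr act0.
have blt : b l < b l.+1 by rewrite lt_neqAle ne.
pose m := Num.min (b l.+1) t; have bm : b l < m by rewrite lt_min blt.
have mb : m <= b l.+1 by rewrite ge_min lexx.
have mt : m <= t by rewrite ge_min lexx orbT.
pose u := (b l + m) / 2.
have ut : 0 <= u < t by rewrite /u; lra.
have ub : b l < u < b l.+1 by rewrite /u; lra.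
have -> : active_length A dl j l = d l.
  rewrite /active_length ifT//; apply/existsP; apply: contrapT => no.
  apply: (unfinished u ut) => v vj; rewrite leNgt; apply/negP => yv; apply: no; exists v.
  by rewrite /A -(piece_alive ub) inE yv vj eqxx.
by rewrite lerD2r.
Qed.

(** The times [t j] need only precede completion, so the bound applies before the algorithm is known
    to finish. *)
Lemma run_bound sigma (c t : job I -> R) : is_schedule sigma ->
  (forall j, 0 <= c j) ->
  (forall j, 0 < weight j ->
     (completion_time (schedule_processing sigma) j <= (c j)%:E)%E) ->
  (forall j, t j <= T) ->
  (forall j u, 0 <= u < t j -> ~ completed y j u) ->
  \sum_j weight j * t j <= 48 * (num_speeds I)%:R * \sum_j weight j * c j.
Proof.
move=> sched c0 cP tT tP; set K := (num_speeds I)%:R; set OPT := \sum_j _ * c j.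
have K1 : 1 <= K by rewrite /K ler1n num_speeds_gt0.
(* This makes the absorbed coefficient [2 * (2 * K + 1) / gam] equal to 1/2, leaving
   [4 * gam * OPT], at most [48 * K * OPT] as [K >= 1]. *)
pose gam := 4 * (2 * K + 1); have gam0 : 0 < gam by rewrite /gam; lra.
have OPT0 : 0 <= OPT by rewrite sumr_ge0// => j _; rewrite mulr_ge0 ?weight_ge0.
(* Piece [l] of the algorithm is matched with the adversary's interval between [b l / gam] and
   [b l.+1 / gam]. *)
pose z i v (l : 'I_N) := busy sigma i v (b l.+1 / gam) - busy sigma i v (b l / gam).
have bg0 l : 0 <= b l / gam by rewrite divr_ge0 ?breakpoint_ge0// ltW.
have bgle l : b l / gam <= b l.+1 / gam by rewrite ler_pM2r ?invr_gt0// breakpoint_le.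
have dg (l : 'I_N) : dl l / gam = b l.+1 / gam - b l / gam by rewrite mulrBl.
have le_active : \sum_j weight j * t j <= \sum_l alive_weight A l * dl l.
  under [leRHS]eq_bigr do rewrite alive_weight_jobs.
  rewrite exchange_big /=; apply: ler_sum => j _; rewrite -mulr_sumr.
  rewrite ler_wpM2l ?weight_ge0//; apply: le_sum_active_length; first exact: tT.
  exact: tP.
apply: le_trans le_active _.
have := @dual_fitting R I N A dl (fun l => d_ge0 l) _ _ _ z c gam gam0 _ _ _ c0 _.
set S := \sum_l _ * _; rewrite -/OPT -/K => DF.
have {DF} : S <= 2 * (gam * OPT + (2 * K + 1) / gam * S).
  apply: DF.
  - by move=> k l; exact: piece_antitone.
  - by move=> v l; exact: piece_requirement.
  - by move=> v; case: (processed v N).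
  - by move=> i v l; rewrite subr_ge0 busy_le.
  - by move=> i l; rewrite dg sum_busy_machine.
  - by move=> v l; rewrite dg sum_busy_task.
  move=> v l w0 vl; rewrite sum_ord_prefix breakpoint0 subr0 => late.
  have : (completion_time (schedule_processing sigma) (job_of v) < (b l.+1 / gam)%:E)%E.
    by apply: le_lt_trans (cP _ w0) _; rewrite lte_fin ltr_pdivlMr// mulrC.
  move=> /completion_time_lt[s /andP[s0 sb] done].
  apply: le_trans (done v erefl) _.
  rewrite exchange_big /= /schedule_processing; apply: ler_sum => i _.
  rewrite -mulr_sumr ler_wpM2l ?(ltW (speed_gt0 i))//.
  rewrite (sum_ord_prefix (fun k => busy sigma i v (b k / gam))).
  by rewrite breakpoint0 mul0r busy0// subr0 -/(busy sigma i v s) busy_le// ltW.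
have -> : (2 * K + 1) / gam = 4^-1 by rewrite /gam invfM mulrCA divff ?mulr1; lra.
move=> h; apply: (@le_trans _ _ (4 * gam * OPT)); first by lra.
by rewrite ler_wpM2r// /gam; lra.
Qed.

End Horizon.
End Run.

(** * Competitive ratio *)

Lemma objective_le (R : realType) (I : instance R) (y : task I -> R -> R)
    (sigma : 'I_(machines I) -> R -> option (task I)) :
  is_run 1 y -> is_schedule sigma ->
  (objective y <= (48 * (num_speeds I)%:R)%:E * objective (schedule_processing sigma))%E.
Proof.
move=> run sched; set K := (num_speeds I)%:R : R; set x := schedule_processing sigma.
have K1 : 1 <= K by rewrite /K ler1n num_speeds_gt0.
have term_ge0 (f : task I -> R -> R) j : (0 <= (weight j)%:E * completion_time f j)%E.
  by rewrite mule_ge0 ?completion_time_ge0// lee_fin weight_ge0.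
have obj0 : (0 <= objective x)%E by apply: sume_ge0 => j _; exact: term_ge0.
have [->|fin] := eqVneq (objective x) +oo%E.
  by rewrite gt0_muley ?leey// lte_fin; lra.
have cfin j : 0 < weight j -> completion_time x j \is a fin_num.
  move=> w0; rewrite ge0_fin_numE ?completion_time_ge0// ltey; apply: contra fin => /eqP e.
  apply/eqP/esum_eqyP => [k _|].
    by rewrite -ltNye (lt_le_trans _ (term_ge0 x k)).
  by exists j; rewrite mem_index_enum e gt0_muley ?lte_fin.
pose c j := fine (completion_time x j).
have c0 j : 0 <= c j by rewrite fine_ge0 ?completion_time_ge0.
have objE : objective x = (\sum_j weight j * c j)%:E.
  rewrite -sumEFin; apply: eq_bigr => j _; rewrite EFinM.
  have := weight_ge0 j; rewrite le_eqVlt => /orP[/eqP <-|w0]; first by rewrite !mul0e.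
  by rewrite fineK ?cfin.
have cP j : 0 < weight j -> (completion_time x j <= (c j)%:E)%E.
  by move=> w0; rewrite /c fineK ?cfin.
set B := \sum_j _ in objE.
have yfin j : 0 < weight j -> completion_time y j \is a fin_num.
  move=> w0; rewrite ge0_fin_numE ?completion_time_ge0// ltey; apply/eqP => e.
  (* An unfinished job of positive weight would accumulate one unit more than [run_bound] allows by
     this horizon. *)
  pose T := (48 * K * B + 1) / weight j.
  have B0 : 0 <= B by rewrite sumr_ge0// => k _; rewrite mulr_ge0 ?weight_ge0.
  have T0 : 0 <= T by rewrite divr_ge0 ?ltW// ltr_wpDl// !mulr_ge0//; lra.
  have := run_bound run T0 (t := fun k => if k == j then T else 0) sched c0 cP.
  rewrite -/K -/B (bigD1 j)//= eqxx big1 => [|k /negbTE ->]; last by rewrite mulr0.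
  have wT : weight j * T = 48 * K * B + 1 by rewrite /T mulrC divfK ?gt_eqF.
  rewrite addr0 wT => h.
  have : 48 * K * B + 1 <= 48 * K * B; last by lra.
  apply: h => k; first by case: ifP.
  move=> u; case: eqP => [->|_] /andP[u0]; last by rewrite ltNge u0.
  by move=> _ /(completion_time_le u0); rewrite e leye_eq.
(* A job of weight 0 may never complete; it contributes 0 and gets the time 0. *)
pose t j := if weight j == 0 then 0 else fine (completion_time y j).
have t0 j : 0 <= t j by rewrite /t; case: ifP => // _; rewrite fine_ge0 ?completion_time_ge0.
have -> : objective y = (\sum_j weight j * t j)%:E.
  rewrite -sumEFin; apply: eq_bigr => j _; rewrite EFinM /t.
  case: eqVneq => [->|w0]; first by rewrite !mul0e.
  by rewrite fineK// yfin// lt0r w0 weight_ge0.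
rewrite objE -EFinM lee_fin.
have T0 : 0 <= \sum_j t j by rewrite sumr_ge0.
apply: (run_bound run T0 sched c0 cP) => [j|j u /andP[u0]].
  by rewrite (bigD1 j)//= lerDl sumr_ge0.
rewrite /t; case: eqVneq => [_|w0]; first by rewrite ltNge u0.
move=> + /(completion_time_le u0).
have w0' : 0 < weight j by rewrite lt0r w0 weight_ge0.
by rewrite -(fineK (yfin j w0')) lee_fin ltNge => /negbTE ->.
Qed.

Lemma num_speeds_le_ratio_bound (R : realType) (K n : nat) : (0 < K)%N ->
  K%:R <= ratio_bound R K n.
Proof.
move=> K0; have K1 : 1 <= K%:R :> R by rewrite ler1n.
have ln_ge0' k : 0 <= ln k%:R :> R.
  (* An instance without tasks relies on the default [ln 0 = 0]. *)
  by case: k => [|k]; [rewrite ln0|rewrite ln_ge0// ler1n].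
rewrite le_min lerDl ln_ge0' andbT.
rewrite -[leLHS]mulr1 ler_pM ?ler01//; first by rewrite exprS ler_peMr// ?exprn_ege1// ler0n.
by rewrite exprn_ege1// lerDl.
Qed.

Theorem theorem2 (R : realType) :
  exists2 C : R, 0 < C &
    forall (I : instance R) (y : task I -> R -> R), is_run 1 y ->
      (objective y
         <= (C * ratio_bound R (num_speeds I) (num_tasks I))%:E * optimum I)%E.
Proof.
exists 48 => // I y run; set r := ratio_bound _ _ _.
have Kr : (num_speeds I)%:R <= r by apply: num_speeds_le_ratio_bound; exact: num_speeds_gt0.
have K1 : 1 <= (num_speeds I)%:R :> R by rewrite ler1n num_speeds_gt0.
rewrite -lee_pdivrMl; last by lra.
apply/ereal_infP => _ [sigma sched <-]; rewrite lee_pdivrMl; last by lra.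
apply: le_trans (objective_le run sched) _; apply: lee_wpmul2r; last by rewrite lee_fin; lra.
apply: sume_ge0 => j _; rewrite mule_ge0 ?completion_time_ge0// lee_fin weight_ge0//.
Qed.
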